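(* Let $\theta_0\in\mathbb{R}^{k_\theta}$ be the tested component of $\beta_0=[\delta_0',\theta_0']'$, and let $\theta^*=[\theta_i^*]_{i=1}^{k_\theta}\in\mathbb{R}^{k_\theta}$ collect the last components of the parsimonious pseudo-true values $\beta_{(i)}^*=[\delta_{(i)}^{*\prime},\theta_i^*]'$, $i=1,\dots,k_\theta$. Under conditions (b), (c), (d) given in the context: $\theta_0=\mathbf{0}_{k_\theta}$ if and only if $\theta^*=\mathbf{0}_{k_\theta}$. Consequently, under $H_0:\theta_0=\mathbf{0}_{k_\theta}$ it follows that $\delta_{(i)}^*=\delta_0$ for every $i$; and under $H_1:\theta_0\neq\mathbf{0}_{k_\theta}$ there exists $i$, $1\le i\le k_\theta$, such that $\theta_i^*\neq 0$.
   Context: Let $k_\delta\in\mathbb{N}$ and $k_\theta\in\mathbb{N}\cup\{\infty\}$ (if $k_\theta=\infty$, the index $i=1,\dots,k_\theta$ runs over $\mathbb{N}$). $\mathcal{D}\subset\mathbb{R}^{k_\delta}$ is compact, $\Theta=\times_{i=1}^{k_\theta}\Theta_i$ with each $\Theta_i\subset\mathbb{R}$ non-empty and compact, and throughout $\Theta\subset\{\theta\in\mathbb{R}^{k_\theta}:|\theta|<\infty\}$, where $|\cdot|$ is the $\ell_1$-norm. $\mathcal{B}=\mathcal{D}\times\Theta$ and $\mathcal{B}_{(i)}=\mathcal{D}\times\Theta_i$, with elements $\beta=[\delta',\theta']'$ and $\beta_{(i)}=[\delta',\theta_i]'$. $\mathbf{0}_k$ is the zero vector of dimension $k$. Derivatives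 of functions with infinite dimensional argument are the (possibly infinite) vectors of partial derivatives. We write $\mathcal{L}(\delta,\theta)$ for $\mathcal{L}(\beta)$. Conditions: (b) The loss $\mathcal{L}:\mathcal{D}\times\Theta\to[0,\infty)$ is continuous and differentiable on $\mathcal{B}$, and $\frac{\partial}{\partial\beta}\mathcal{L}(\beta)=0$ if and only if $\beta=\beta_0=[\delta_0',\theta_0']'\in\mathcal{B}$, where $\beta_0$ is unique (it is the unique minimizer of $\mathcal{L}$ on $\mathcal{B}$), and $\delta_0$ and $\theta_{0,i}$ are interior points of $\mathcal{D}$ and $\Theta_i$. (c) The parsimonious losses $\mathcal{L}_{(i)}:\mathcal{B}_{(i)}\to[0,\infty)$ are continuous and differentiable on the compact set $\mathcal{B}_{(i)}$. The $\beta_{(i)}^*$ (unique minimizer of $\mathcal{L}_{(i)}$ on $\mathcal{B}_{(i)}$) is the unique interior point of $\mathcal{D}\times\Theta_i$ satisfying: $\frac{\partial}{\partial\beta_{(i)}}\mathcal{L}_{(i)}(\beta_{(i)})=0$ if and only if $\beta_{(i)}=\beta_{(i)}^*=[\delta_{(i)}^{*\prime},\theta_i^*]'$. (d) The losses are linked by $\mathcal{L}_{(i)}(\beta_{(i)})=\mathcal{L}(\delta,[0,\dots,\theta_i,0,\dots]')$ for all $\beta_{(i)}\in\mathcal{B}_{(i)}$, where $[0,\dots,\theta_i,0,\dots]'$ is the zero vector except for its $i$-th element $\theta_i$. *)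

(* Defs.v *)
From HB Require Import structures.
From mathcomp Require Import all_boot all_order all_algebra.
From mathcomp Require Import all_classical all_reals all_analysis.
Import Order.TTheory GRing.Theory Num.Theory.
Import numFieldNormedType.Exports.

Set Implicit Arguments.
Unset Strict Implicit.
Unset Printing Implicit Defensive.

Local Open Scope classical_set_scope.
Local Open Scope ring_scope.

(* Extended naturals are encoded as [option nat], with [None] for infinity;
   indices start at 0. *)
Definition theta_index (k : option nat) : countType :=
  if k is Some n then 'I_n else nat.

(* [0, ..., 0, t, 0, ...] with [t] in position [i]. *)
Definition single (R : realType) (k : option nat) (i : theta_index k) (t : R) :
    theta_index k -> R :=
  fun j => if j == i then t else 0.

Definition l1norm (R : realType) (k : option nat) (t : theta_index k -> R) :
    \bar R :=
  \esum_(i in [set: theta_index k]) `|t i|%:E.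

Definition l1_nbhs (R : realType) (k : option nat) (t : theta_index k -> R) :
    set_system (theta_index k -> R) :=
  filter_from [set e : R | 0 < e]
    (fun e => [set t' | (l1norm (fun i => t' i - t i)%R < e%:E)%E]).

Definition box (R : realType) (k : option nat)
    (Theta : theta_index k -> set R) : set (theta_index k -> R) :=
  [set t | forall i, Theta i (t i)].

(* Infinitely many coordinates carry the l1 norm, not the product topology
   that the library puts on functions. *)
Definition l1_continuous_on (R : realType) (kd : nat) (k : option nat)
    (S : set ('rV[R]_kd * (theta_index k -> R)))
    (f : 'rV[R]_kd * (theta_index k -> R) -> R) :=
  forall b, S b ->
    f @ within S (filter_prod (nbhs b.1) (l1_nbhs b.2)) --> f b.

Definition minimizer_on (R : realType) (T : Type) (S : set T) (f : T -> R)
    (x : T) :=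
  S x /\ forall y, S y -> f x <= f y.

(* Derivative along [e] of a function with domain [S]: only increments that
   stay in [S] are used, so it is one-sided at the ends of an interval. When
   no small nonzero increment along [e] stays in [S], the values of [f] on [S]
   do not determine the derivative and [d] is unconstrained. *)
Definition is_partial (R : realType) (V : lmodType R) (S : set V) (f : V -> R)
    (x e : V) (d : R) :=
  (f (x + h *: e) - f x) / h @[h --> within [set h | S (x + h *: e)] 0^'] --> d.

(* [g] is the vector of all partial derivatives of [f] at [b]. *)
Definition is_gradient (R : realType) (kd : nat) (k : option nat)
    (S : set ('rV[R]_kd * (theta_index k -> R)))
    (f : 'rV[R]_kd * (theta_index k -> R) -> R)
    (b g : 'rV[R]_kd * (theta_index k -> R)) :=
  (forall j, is_partial S f b (delta_mx 0 j, 0) (g.1 0 j)) /\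
  (forall i, is_partial S f b (0, single i 1) (g.2 i)).

Definition is_gradient1 (R : realType) (kd : nat)
    (S : set ('rV[R]_kd * R)) (f : 'rV[R]_kd * R -> R) (b g : 'rV[R]_kd * R) :=
  (forall j, is_partial S f b (delta_mx 0 j, 0) (g.1 0 j)) /\
  is_partial S f b (0, 1) g.2.

(* Main.v *)
Require Import Defs.
From HB Require Import structures.
From mathcomp Require Import all_boot all_order all_algebra.
From mathcomp Require Import all_classical all_reals all_analysis.
Import Order.TTheory GRing.Theory Num.Theory.
Import numFieldNormedType.Exports.
Local Open Scope classical_set_scope.
Local Open Scope ring_scope.

(** The loss [L1 i] is the loss [L] seen through the linear embedding
    [(delta, t) |-> (delta, single i t)], and all these slices share the
    points [(delta, 0)]. This drives both implications.

    If [theta0 = 0], the global minimizer [(delta0, 0)] of [L] lies on every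
    slice, so [(delta0, 0)] minimizes every [L1 i]; uniqueness of the
    minimizers gives [thetas i = 0] and [deltas i = delta0].

    Conversely, suppose that [thetas = 0]. Every [deltas i] then minimizes the
    same function [delta |-> L (delta, 0)], so uniqueness of the minimizer of
    [L1 i] makes all [deltas i] equal to one [delta] ([slice_minimizers_agree]).
    At [(delta, 0)] each partial derivative of [L] is a partial derivative of
    some [L1 i] ([is_partial_pullback]), and those vanish there. Hence
    [(delta, 0)] is a critical point of [L], and the only one is
    [(delta0, theta0)]. Interiority of [(deltas i, thetas i)] enters here: it
    makes partial derivatives unique ([is_partial_unique]), so that the given
    gradients of [L] and of [L1 i] can be compared.

    When there is no index [i] at all, the converse holds because [theta0] is
    an empty family. *)

(** At a point of the interior, every small increment along [e] stays in [S],
    so the restricted filter defining [is_partial] is proper and limits along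
    it are unique. *)
Lemma is_partial_unique (R : realType) (V : normedModType R) (S : set V)
    (f : V -> R) (x e : V) (d d' : R) :
  interior S x -> is_partial S f x e d -> is_partial S f x e d' -> d = d'.
Proof.
move=> Sx fd fd'.
have line_cvg : x + h *: e @[h --> (0 : R)] --> x.
  rewrite -[X in _ --> X]addr0 -[X in _ --> _ + X](scale0r e).
  by apply: cvgD; [exact: cvg_cst | apply: cvgZr_tmp; exact: cvg_id].
have S_near : \forall h \near (0 : R)^', S (x + h *: e).
  by apply: nbhs_dnbhs; exact: line_cvg.
have proper : ProperFilter (within [set h | S (x + h *: e)] (0 : R)^').
  split; last exact: within_filter.
  rewrite /within /= => S_empty.
  suff : \forall h \near (0 : R)^', False by exact: filter_not_empty.
  by apply: filterS2 S_near S_empty => h Sh; apply.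
exact: (@cvg_unique _ _ _ _ _ _ fd fd').
Qed.

(** The difference quotients of [f] along [e] are those of [g] along [e'], and
    they are admissible for the same increments. *)
Lemma is_partial_pullback (R : realType) (V W : lmodType R) (phi : V -> W)
    (S : set V) (T : set W) (f : V -> R) (g : W -> R) (x e : V) (e' : W)
    (d : R) :
  (forall h, phi (x + h *: e) = phi x + h *: e') ->
  (forall v, T (phi v) <-> S v) ->
  (forall v, S v -> f v = g (phi v)) ->
  S x ->
  is_partial T g (phi x) e' d -> is_partial S f x e d.
Proof.
move=> phi_line TS fg Sx; rewrite /is_partial.
have -> : [set h | T (phi x + h *: e')] = [set h | S (x + h *: e)].
  by apply/seteqP; split => h /=; rewrite -phi_line => /TS.
apply: cvg_trans; apply: near_eq_cvg; rewrite near_withinE.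
by apply: nearW => h Sh; rewrite -phi_line !fg.
Qed.

Lemma single0 (R : realType) (k : option nat) (i : theta_index k) :
  single i (0 : R) = 0.
Proof. by apply/funext => j; rewrite /single; case: ifP. Qed.

Lemma single_line (R : realType) (k : option nat) (i : theta_index k)
    (t h s : R) :
  single i (t + h * s) = single i t + h *: single i s.
Proof.
apply/funext => j; change (single i (t + h * s) j =
  single i t j + h * single i s j).
by rewrite /single; case: ifP => // _; rewrite mulr0 addr0.
Qed.

Lemma unique_minimizer_on {R : realType} {T : Type} {S : set T} {f : T -> R}
    {x y : T} :
  unique (minimizer_on S f) x -> S y -> f y <= f x -> x = y.
Proof.
move=> [[Sx xmin] xuniq] Sy yx; apply: xuniq; split => // z Sz.
exact: le_trans yx (xmin z Sz).
Qed.

(** Both [delta] and [delta'] minimize the common restriction of [f] and [g] to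
    the slice [t = 0], so [(delta', 0)] is as good as [(delta, 0)] for [f]. *)
Lemma slice_minimizers_agree (R : realType) (V : Type) (D : set V)
    (A B : set R) (f g : V * R -> R) (delta delta' : V) :
  (forall v, D v -> f (v, 0) = g (v, 0)) ->
  unique (minimizer_on (D `*` A) f) (delta, 0) ->
  unique (minimizer_on (D `*` B) g) (delta', 0) ->
  delta = delta'.
Proof.
move=> fg fmin [[[Dd' B0] gmin] _].
have [[[Dd A0] _] _] := fmin.
suff [] : (delta, 0 : R) = (delta', 0) by [].
apply: (unique_minimizer_on fmin); first by split.
by rewrite !fg //; apply: gmin.
Qed.

Theorem theorem2p1 (R : realType) (kd : nat) (k : option nat)
    (D : set 'rV[R]_kd) (Theta : theta_index k -> set R)
    (L : 'rV[R]_kd * (theta_index k -> R) -> R)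
    (gradL : 'rV[R]_kd * (theta_index k -> R) ->
       'rV[R]_kd * (theta_index k -> R))
    (L1 : theta_index k -> 'rV[R]_kd * R -> R)
    (gradL1 : theta_index k -> 'rV[R]_kd * R -> 'rV[R]_kd * R)
    (delta0 : 'rV[R]_kd) (theta0 : theta_index k -> R)
    (deltas : theta_index k -> 'rV[R]_kd) (thetas : theta_index k -> R) :
  (* the parameter spaces *)
  compact D ->
  (forall i, Theta i !=set0) ->
  (forall i, compact (Theta i)) ->
  (forall theta, box Theta theta -> (l1norm theta < +oo)%E) ->
  (* (b) *)
  (forall b, (D `*` box Theta) b -> 0 <= L b) ->
  l1_continuous_on (D `*` box Theta) L ->
  (forall b, (D `*` box Theta) b ->
     is_gradient (D `*` box Theta) L b (gradL b)) ->
  (forall b, (D `*` box Theta) b ->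
     (gradL b = 0 <-> b = (delta0, theta0))) ->
  unique (minimizer_on (D `*` box Theta) L) (delta0, theta0) ->
  interior D delta0 ->
  (forall i, interior (Theta i) (theta0 i)) ->
  (* (c) *)
  (forall i b, (D `*` Theta i) b -> 0 <= L1 i b) ->
  (forall i, {within D `*` Theta i, continuous (L1 i)}) ->
  (forall i b, (D `*` Theta i) b ->
     is_gradient1 (D `*` Theta i) (L1 i) b (gradL1 i b)) ->
  (forall i b, (D `*` Theta i) b ->
     (gradL1 i b = 0 <-> b = (deltas i, thetas i))) ->
  (forall i, unique (minimizer_on (D `*` Theta i) (L1 i))
               (deltas i, thetas i)) ->
  (forall i, interior (D `*` Theta i) (deltas i, thetas i)) ->
  (* (d); the first conjunct says that L is evaluated inside its domain *)
  (forall i delta t, D delta -> Theta i t ->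
     box Theta (single i t) /\ L1 i (delta, t) = L (delta, single i t)) ->
  (theta0 = 0 <-> thetas = 0) /\
  (theta0 = 0 -> forall i, deltas i = delta0) /\
  (theta0 <> 0 -> exists i, thetas i <> 0).
Proof.
move=> _ _ _ _ _ _ gradLP gradL0 Lmin _ theta0_int _ _ gradL1P gradL10 L1min
  ds_int link.
have forward : theta0 = 0 -> forall i, deltas i = delta0 /\ thetas i = 0.
  move=> theta00 i.
  have [[[/= Dd0 _] Lle] _] := Lmin.
  have T0 : Theta i 0.
    by have := interior_subset (theta0_int i); rewrite theta00.
  suff [-> ->] : (deltas i, thetas i) = (delta0, 0) by [].
  apply: (unique_minimizer_on (L1min i)); first by split.
  have [[[/= Dds Tts] _] _] := L1min i.
  rewrite (link _ _ _ Dd0 T0).2 (link _ _ _ Dds Tts).2 single0 -theta00.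
  by apply: Lle; split => //; exact: (link _ _ _ Dds Tts).1.
have backward : thetas = 0 -> theta0 = 0.
  move=> thetas0; apply/funext => i0.
  have th0 i : thetas i = 0 by rewrite thetas0.
  have T0 i : Theta i 0.
    by have [[[_ /=]]] := L1min i; rewrite th0.
  have deltasE i : deltas i = deltas i0.
    have := L1min i0; have := L1min i; rewrite !th0.
    apply: slice_minimizers_agree => v Dv.
    by rewrite (link _ _ _ Dv (T0 _)).2 (link _ _ _ Dv (T0 _)).2 !single0.
  set b := (deltas i0, 0 : theta_index k -> R).
  have Dds : D (deltas i0) by have [[[]]] := L1min i0.
  have Sb : (D `*` box Theta) b by split => //= i; exact: T0.
  pose phi (i : theta_index k) (v : 'rV[R]_kd * R) := (v.1, single i v.2).
  have phib i : phi i (deltas i, thetas i) = b.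
    by rewrite /phi /= th0 single0 deltasE.
  have phiS i v : (D `*` box Theta) (phi i v) <-> (D `*` Theta i) v.
    case: v => v t; split => -[/= Dv Tt]; split => //=.
      by have := Tt i; rewrite /single eqxx.
    exact: (link _ _ _ Dv Tt).1.
  have L1E i v : (D `*` Theta i) v -> L1 i v = L (phi i v).
    by case: v => v t [/= Dv Tt]; exact: (link _ _ _ Dv Tt).2.
  have S1 i : (D `*` Theta i) (deltas i, thetas i) by have [[]] := L1min i.
  have phi_line i v w h : phi i (v + h *: w) = phi i v + h *: phi i w.
    by rewrite /phi /= single_line.
  have pull i e d : is_partial (D `*` box Theta) L b (phi i e) d ->
      is_partial (D `*` Theta i) (L1 i) (deltas i, thetas i) e d.
    rewrite -(phib i); apply: is_partial_pullback => //; exact: L1E.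
  have grad1_0 i : gradL1 i (deltas i, thetas i) = 0 by apply/gradL10.
  have [dpart tpart] := gradLP b Sb.
  (* [pull] turns each partial derivative of [L] at [b] into one of an [L1 i],
     where it is compared with the zero gradient; any index serves for the
     [delta] coordinates, hence [i0]. *)
  have gradb : gradL b = 0.
    rewrite [gradL b]surjective_pairing; congr pair.
      apply/rowP => j; rewrite mxE.
      have [d1 _] := gradL1P i0 _ (S1 i0).
      have {d1} := d1 j; rewrite grad1_0 mxE; apply: is_partial_unique => //.
      by apply: pull; rewrite /phi /= single0; exact: dpart.
    apply/funext => i.
    have [_] := gradL1P i _ (S1 i).
    rewrite grad1_0; apply: is_partial_unique => //.
    by apply: pull; rewrite /phi /=; exact: tpart.
  by have [/(_ gradb) [_ <-] _] := gradL0 b Sb.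
split; last split.
- by split=> [/forward th0|//]; apply/funext => i; have [] := th0 i.
- by move=> /forward th0 i; have [] := th0 i.
- move=> theta0N; apply: contrapT => no_i; apply: theta0N; apply: backward.
  by apply/funext => i; apply: contrapT => thi; apply: no_i; exists i.
Qed.
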